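(* The function $f_2:\mathbb{N}\to\mathbb{N}$ is strictly increasing, i.e. $f_2(n) < f_2(n+1)$ for every integer $n \geq 1$.
   Context: An oriented graph is a finite directed graph with no loops, no multiple arcs and no directed cycle of length $2$ (i.e. no pair of opposite arcs). The weak diameter of an oriented graph $\overrightarrow{G}$ is the minimum $d$ such that for any two distinct vertices $u,v$ there is a directed path of length at most $d$ from $u$ to $v$ or from $v$ to $u$. For $n\ge 1$, $f_2(n)$ denotes the minimum number of arcs of an oriented graph on $n$ vertices having weak diameter at most $2$. *)

(* Defs.v *)
From mathcomp Require Import all_boot.

Set Implicit Arguments.
Unset Strict Implicit.
Unset Printing Implicit Defensive.

Section Digraphs.
Variable V : finType.
Implicit Types (A : {set V * V}) (u v : V) (d : nat).

Definition arc A : rel V := fun u v => (u, v) \in A.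

Definition oriented A :=
  [forall u, ~~ arc A u u] && [forall u, forall v, ~~ (arc A u v && arc A v u)].

(* The path u :: p has size p arcs. *)
Definition dipath A u v (p : seq V) :=
  [&& path (arc A) u p, uniq (u :: p) & last u p == v].

Definition dipath_le A d u v :=
  [exists k : 'I_d.+1, exists p : k.-tuple V, dipath A u v p].

Definition weakly_within A d :=
  [forall u, forall v,
    (u != v) ==> (dipath_le A d u v || dipath_le A d v u)].

(* None when some two vertices are not joined by a directed path in either
   direction. Directed paths have fewer than #|V| arcs, so looking for the
   minimum up to #|V| loses nothing; see weak_diameterP. *)
Definition weak_diameter A : option nat :=
  ohead [seq d <- iota 0 #|V|.+1 | weakly_within A d].

Definition weak_diameter_le A d :=
  if weak_diameter A is Some d' then d' <= d else false.

Lemma dipath_leP A d u v :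
  reflect (exists2 p, dipath A u v p & size p <= d) (dipath_le A d u v).
Proof.
apply: (iffP existsP) => [[k /existsP[p Hp]]|[p Hp Hs]].
  by exists p => //; rewrite size_tuple -ltnS.
rewrite -ltnS in Hs; exists (Ordinal Hs); apply/existsP.
by exists (in_tuple p).
Qed.

Lemma weakly_within_card A d : weakly_within A d -> weakly_within A #|V|.
Proof.
have short x y : dipath_le A d x y -> dipath_le A #|V| x y.
  case/dipath_leP=> p Hp _; apply/dipath_leP; exists p => //.
  case/and3P: Hp => _ U _; have := max_card (mem (x :: p)).
  by rewrite (card_uniqP U) /= => /ltnW.
move/forallP=> H; apply/forallP=> u; apply/forallP=> v; apply/implyP=> uv.
have /implyP/(_ uv)/orP[] := forallP (H u) v; move/short => -> //.
by rewrite orbT.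
Qed.

Lemma weak_diameterP A d :
  weak_diameter A = Some d <->
  weakly_within A d /\ forall d', weakly_within A d' -> d <= d'.
Proof.
have headP (P : pred nat) n m : ohead (filter P (iota m n)) = Some d <->
    [/\ m <= d < m + n, P d & forall d', m <= d' -> P d' -> d <= d'].
  elim: n m => [|n IHn] m /=.
    by split=> // -[]; rewrite addn0; case: leqP.
  case Pm: (P m) => /=.
    split=> [[<-]|[/andP[le_md _] _ min]].
      by split=> //; rewrite leqnn /= addnS ltnS leq_addr.
    by congr Some; apply/eqP; rewrite eqn_leq le_md min.
  apply: (iff_trans (IHn m.+1)); rewrite addSnnS; split=> -[/andP[lo hi] Pd min]; split=> //.
  - by rewrite (ltnW lo).
  - move=> d' le_md' Pd'; apply: min => //; rewrite ltn_neqAle le_md' andbT.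
    by apply: contraTneq Pd' => <-; rewrite Pm.
  - rewrite hi andbT ltn_neqAle lo andbT.
    by apply: contraTneq Pd => <-; rewrite Pm.
  - by move=> d' /ltnW; apply: min.
apply: (iff_trans (headP _ _ _)); split=> [[_ Pd min]|[Pd min]].
  by split=> // d'; apply: min.
split=> // [|d' _]; last exact: min.
by rewrite add0n ltnS min // (weakly_within_card Pd).
Qed.

Lemma weak_diameter_leP A d :
  reflect (exists2 d', weakly_within A d' & d' <= d) (weak_diameter_le A d).
Proof.
rewrite /weak_diameter_le; case E: (weak_diameter A) => [e|].
  have [We min] := (weak_diameterP A e).1 E.
  apply: (iffP idP) => [le_ed|[d' /min]]; first by exists e.
  exact: leq_trans.
right=> -[d' Wd' _]; have exW : exists d', weakly_within A d' by exists d'.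
case: (ex_minnP exW) => m Wm min.
by have := (weak_diameterP A m).2 (conj Wm min); rewrite E.
Qed.

End Digraphs.

Definition f2_attains n m :=
  [exists A : {set 'I_n * 'I_n},
    [&& oriented A, weak_diameter_le A 2 & #|A| == m]].

(* Witnessed by the transitive tournament. *)
Lemma f2_attains_ex n : exists m, f2_attains n m.
Proof.
pose A : {set 'I_n * 'I_n} := [set p : 'I_n * 'I_n | p.1 < p.2].
exists #|A|; apply/existsP; exists A; rewrite eqxx andbT; apply/andP; split.
  apply/andP; split; apply/forallP=> u; first by rewrite /arc inE ltnn.
  by apply/forallP=> v; rewrite /arc !inE /=; case: ltngtP.
apply/weak_diameter_leP; exists 1 => //.
have one (u v : 'I_n) : u < v -> dipath_le A 1 u v.
  move=> uv; apply/dipath_leP; exists [:: v] => //.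
  by rewrite /dipath /= /arc !inE /= uv eqxx !andbT neq_ltn uv.
apply/forallP=> u; apply/forallP=> v; apply/implyP.
by rewrite neq_ltn => /orP[] /one ->; rewrite ?orbT.
Qed.

Definition f2 n := ex_minn (f2_attains_ex n).

(* Main.v *)
(** Call [z] a connector of [u, v] when [u -> z -> v] or [v -> z -> u], and a
    twin neighbour when [z] is a common in-neighbour or a common out-neighbour.
    Start from an optimal graph on [n.+1] vertices.
    If [u, v] have no connector, then they are adjacent, and identifying them
    creates no pair of opposite arcs and loses the arc between them.
    Pushing a vertex (reversing all its arcs) preserves the connectors of the
    pairs avoiding it, and exchanges connectors and twin neighbours for the pairs
    containing it. So if [u, v] have no twin neighbour, push [v] and identify.
    If every pair has both a connector and a twin neighbour, then all the pushed
    graphs still have weak diameter at most [2]; pushing the in-neighbours of [v]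
    makes [v] a source, which can then be deleted. *)
Require Import Defs.
From mathcomp Require Import all_boot.
(* Both [Defs] and [mathcomp.boot.path] define [arc]: this restores the former. *)
Import Defs.

Set Implicit Arguments.
Unset Strict Implicit.
Unset Printing Implicit Defensive.

(** * Pushing, connectors and twin neighbours *)

Section Push.
Variable V : finType.
Implicit Types (A : {set V * V}) (Z : {set V}) (x y z : V).

Definition adjacent A x y := arc A x y || arc A y x.

Definition connector A x y z :=
  (arc A x z && arc A z y) || (arc A y z && arc A z x).

Definition twin_nbr A x y z :=
  (arc A x z && arc A y z) || (arc A z x && arc A z y).

Definition close A x y := adjacent A x y || [exists z, connector A x y z].

Lemma orientedP A :
  reflect ((forall x, arc A x x = false) /\
           (forall x y, arc A x y -> arc A y x -> False))
          (oriented A).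
Proof.
apply: (iffP andP) => [[/forallP irr /forallP asym]|[irr asym]].
  split=> [x|x y xy yx]; first exact/negbTE.
  by have /forallP/(_ y) := asym x; rewrite xy yx.
split; apply/forallP=> x; first by rewrite irr.
by apply/forallP=> y; apply/negP=> /andP[/asym].
Qed.

Lemma weak_diameter_le2P A : oriented A ->
  reflect (forall x y, x != y -> close A x y) (weak_diameter_le A 2).
Proof.
case/orientedP=> irr _.
have short x y : dipath_le A 2 x y ->
    [|| x == y, arc A x y | [exists z, arc A x z && arc A z y]].
  case/dipath_leP=> -[|z [|t [|w p]]] // /and3P[] /=.
  - by move=> _ _ ->.
  - by rewrite andbT => xz _ /eqP<- _; rewrite xz orbT.
  - case/and3P=> xz zt _ _ /eqP<- _.
    by apply/or3P/Or33/existsP; exists z; rewrite xz.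
have long x y : x != y -> arc A x y || [exists z, arc A x z && arc A z y] ->
    dipath_le A 2 x y.
  move=> xy /orP[axy|/existsP[z /andP[xz zy]]]; apply/dipath_leP.
    by exists [:: y] => //; rewrite /dipath /= axy inE xy eqxx.
  (* Without loops [z] differs from both ends, so the walk [x -> z -> y] is a path. *)
  have nxz : x != z by apply: contraTneq xz => ->; rewrite irr.
  have nzy : z != y by apply: contraTneq zy => ->; rewrite irr.
  by exists [:: z; y] => //; rewrite /dipath /= xz zy !inE negb_or nxz xy nzy eqxx.
have mono d x y : d <= 2 -> dipath_le A d x y -> dipath_le A 2 x y.
  move=> d2 /dipath_leP[p Hp sp]; apply/dipath_leP; exists p => //.
  exact: leq_trans d2.
apply: (iffP (weak_diameter_leP _ _)) => [[d /forallP W d2] x y xy|H].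
  have /forallP/(_ y)/implyP/(_ xy) := W x.
  rewrite /close /adjacent; case/orP=> /(mono _ _ _ d2)/short.
    rewrite (negbTE xy) /= => /orP[->//|/existsP[z Hz]].
    by apply/orP; right; apply/existsP; exists z; rewrite /connector Hz.
  rewrite eq_sym (negbTE xy) /= => /orP[->|/existsP[z Hz]]; first by rewrite orbT.
  by apply/orP; right; apply/existsP; exists z; rewrite /connector Hz orbT.
exists 2 => //; apply/forallP=> x; apply/forallP=> y; apply/implyP=> xy.
have yx : y != x by rewrite eq_sym.
case/orP: (H _ _ xy) => [/orP[a|a]|/existsP[z /orP[a|a]]].
- by rewrite long // a.
- by rewrite orbC long // a.
- by rewrite long //; apply/orP; right; apply/existsP; exists z.
- by rewrite orbC long //; apply/orP; right; apply/existsP; exists z.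
Qed.

(** Pushing each vertex of [Z] once reverses an arc once per end in [Z], so only arcs with exactly
    one end there change. Written as an involution on pairs, it visibly preserves the number of
    arcs. *)
Definition push_arc Z (a : V * V) :=
  if (a.1 \in Z) (+) (a.2 \in Z) then (a.2, a.1) else a.

Definition push Z A : {set V * V} := push_arc Z @^-1: A.

Lemma push_arcK Z : involutive (push_arc Z).
Proof.
case=> x y; rewrite [push_arc Z (x, y)]/push_arc /=.
by case E: (_ (+) _); rewrite /push_arc /= ?E // addbC E.
Qed.

Lemma card_push Z A : #|push Z A| = #|A|.
Proof. exact/on_card_preimset/onW_bij/inv_bij/push_arcK. Qed.

Lemma arc_push Z A x y :
  arc (push Z A) x y = if (x \in Z) (+) (y \in Z) then arc A y x else arc A x y.
Proof. by rewrite /arc inE /push_arc /=; case: ifP. Qed.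

Lemma oriented_push Z A : oriented A -> oriented (push Z A).
Proof.
case/orientedP=> irr asym; apply/orientedP; split=> [x|x y].
  by rewrite arc_push addbb irr.
by rewrite !arc_push addbC; case: ifP => _ xy yx; apply: (asym x y).
Qed.

Lemma adjacent_push Z A x y : adjacent (push Z A) x y = adjacent A x y.
Proof. by rewrite /adjacent !arc_push addbC; case: ifP; rewrite // orbC. Qed.

(** Pushing [z] reverses both of its arcs, which preserves either relation; pushing exactly one of
    [x, y] reverses one of the two arcs, which exchanges the relations. *)
Lemma connector_push Z A x y z :
  connector (push Z A) x y z =
  if (x \in Z) (+) (y \in Z) then twin_nbr A x y z else connector A x y z.
Proof.
rewrite /connector /twin_nbr !arc_push.
case: (x \in Z); case: (y \in Z); case: (z \in Z) => /=;
  by case: (arc A x z); case: (arc A z x); case: (arc A y z); case: (arc A z y).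
Qed.

Lemma twin_nbr_push Z A x y z :
  twin_nbr (push Z A) x y z =
  if (x \in Z) (+) (y \in Z) then connector A x y z else twin_nbr A x y z.
Proof.
rewrite /connector /twin_nbr !arc_push.
case: (x \in Z); case: (y \in Z); case: (z \in Z) => /=;
  by case: (arc A x z); case: (arc A z x); case: (arc A y z); case: (arc A z y).
Qed.

End Push.

(** * Bounding [f2] by deleting or identifying vertices *)

Lemma f2_spec n : exists A : {set 'I_n * 'I_n},
  [/\ oriented A, forall x y, x != y -> close A x y & #|A| = f2 n].
Proof.
rewrite /f2; case: ex_minnP => m /existsP[A /and3P[oA wA /eqP cA]] _.
by exists A; split=> //; apply/weak_diameter_le2P.
Qed.

Lemma f2_le n (A : {set 'I_n * 'I_n}) : oriented A ->
  (forall x y, x != y -> close A x y) -> f2 n <= #|A|.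
Proof.
move=> oA cA; rewrite /f2; case: ex_minnP => m _; apply.
by apply/existsP; exists A; rewrite oA eqxx andbT; apply/weak_diameter_le2P.
Qed.

(** What remains without [v] is relabelled by ['I_n] along [lift v]; only connectors other than [v]
    survive. *)
Lemma f2_delete n (A : {set 'I_n.+1 * 'I_n.+1}) (v : 'I_n.+1) : oriented A ->
  (forall x y, x != v -> y != v -> x != y ->
     adjacent A x y || [exists z, (z != v) && connector A x y z]) ->
  f2 n <= #|[set a in A | (a.1 != v) && (a.2 != v)]|.
Proof.
move=> oA cA; pose e (i : 'I_n) := lift v i.
pose ee (a : 'I_n * 'I_n) := (e a.1, e a.2).
have ee_inj : injective ee.
  move=> [i j] [i' j'] eq_ee; congr pair.
    exact: lift_inj (congr1 fst eq_ee).
  exact: lift_inj (congr1 snd eq_ee).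
pose B := ee @^-1: A.
have arcB i j : arc B i j = arc A (e i) (e j) by rewrite /arc inE.
have nv i : e i != v by rewrite eq_sym neq_lift.
have leB : #|B| <= #|[set a in A | (a.1 != v) && (a.2 != v)]|.
  rewrite -(card_imset _ ee_inj); apply/subset_leq_card/subsetP=> a /imsetP[b].
  by rewrite inE => Ab ->; rewrite inE Ab /= !nv.
apply: leq_trans leB; apply: f2_le.
  have /orientedP[irr asym] := oA.
  by apply/orientedP; split=> [i|i j]; rewrite !arcB //; apply: asym.
move=> i j ij; have /(cA _ _ (nv i) (nv j)) : e i != e j.
  by rewrite (inj_eq (@lift_inj _ v)).
rewrite /close /adjacent !arcB => /orP[->//|/existsP[z /andP[zv cz]]].
apply/orP; right; apply/existsP; rewrite eq_sym in zv.
case: (unlift_some zv) => k zk _; exists k.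
by rewrite /connector !arcB /e -zk.
Qed.

(** Redirecting the arcs at [v] to [u] and dropping loops isolates [v], which is then deleted. *)
Lemma f2_identify n (A : {set 'I_n.+1 * 'I_n.+1}) (u v : 'I_n.+1) :
  oriented A -> u != v ->
  (forall x y, x != v -> y != v -> x != y -> close A x y) ->
  (forall z, ~~ connector A u v z) ->
  adjacent A u v || [exists z, twin_nbr A u v z] ->
  f2 n < #|A|.
Proof.
move=> oA uv cA noc near; have [irr asym] := orientedP _ oA.
pose f x := if x == v then u else x.
pose ff (a : 'I_n.+1 * 'I_n.+1) := (f a.1, f a.2).
pose B := [set a in ff @: A | a.1 != a.2].
have fv : f v = u by rewrite /f eqxx.
have fid x : x != v -> f x = x by rewrite /f => /negbTE->.
have fu : f u = u by rewrite fid.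
have fnv x : f x != v by rewrite /f; case: ifP => // ->.
have fI x y : f x = f y -> [\/ x = y, x = u /\ y = v | x = v /\ y = u].
  rewrite /f; case: (x =P v) => [->|_]; case: (y =P v) => [->|_] e;
    by [constructor 1|constructor 3|constructor 2].
have arcB x y : reflect [/\ x != y & exists a b, [/\ arc A a b, f a = x & f b = y]]
                        (arc B x y).
  rewrite /arc inE /=; apply: (iffP andP) => [[/imsetP[[a b] ab [-> ->]] xy]|].
    by split=> //; exists a, b.
  case=> xy [a [b [ab fa fb]]]; split=> //.
  by apply/imsetP; exists (a, b); rewrite // /ff /= fa fb.
have arcf x y : f x != f y -> arc A x y -> arc B (f x) (f y).
  by move=> xy axy; apply/arcB; split=> //; exists x, y.
have noc1 z : arc A u z -> arc A z v -> False.
  by move=> a b; have := noc z; rewrite /connector a b.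
have noc2 z : arc A v z -> arc A z u -> False.
  by move=> a b; have := noc z; rewrite /connector a b orbT.
have oB : oriented B.
  apply/orientedP; split=> [x|x y].
    by apply/negP=> /arcB[]; rewrite eqxx.
  (* Opposite arcs of [B] lift to opposite arcs of [A] or to a two-arc path between [u] and [v],
     that is, a connector. *)
  case/arcB=> xy [a [b [ab fa fb]]] /arcB[_ [c [d [cd fc fd]]]].
  rewrite -{}fa -{}fb in xy fc fd; move: (fI _ _ fd) (fI _ _ fc) ab cd xy.
  case=> [->|[-> ->]|[-> ->]]; case=> [->|[-> ->]|[-> ->]] ab cd xy;
    solve [ exact: (asym _ _ ab cd) | exact: (noc1 _ ab cd)
          | exact: (noc2 _ ab cd) | exact: (noc1 _ cd ab)
          | exact: (noc2 _ cd ab) | by rewrite ?fu ?fv eqxx in xy ].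
have cB x y : x != v -> y != v -> x != y ->
    adjacent B x y || [exists z, (z != v) && connector B x y z].
  move=> xv yv xy; have fxy : f x != f y by rewrite !fid.
  have fyx : f y != f x by rewrite eq_sym.
  suff two s t z : s != v -> t != v -> s != t -> arc A s z -> arc A z t ->
      [|| arc B s t | [exists z, (z != v) && (arc B s z && arc B z t)]].
    case/orP: (cA _ _ xv yv xy) => [/orP[/(arcf _ _ fxy)|/(arcf _ _ fyx)]|].
    - by rewrite !fid // /adjacent => ->.
    - by rewrite !fid // /adjacent => ->; rewrite orbT.
    case/existsP=> z /orP[]/andP[a b].
      have /orP[|/existsP[w /andP[wv w2]]] := two _ _ _ xv yv xy a b.
        by rewrite /adjacent => ->.
      by apply/orP; right; apply/existsP; exists w; rewrite wv /connector w2.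
    rewrite eq_sym in xy; have /orP[|/existsP[w /andP[wv w2]]] := two _ _ _ yv xv xy a b.
      by rewrite /adjacent => ->; rewrite orbT.
    by apply/orP; right; apply/existsP; exists w; rewrite wv /connector w2 orbT.
  (* The path maps to [s -> f z -> t], which collapses to the arc [s -> t] if [f z] is [s] or
     [t]. *)
  move=> sv tv st sz zt.
  have Bsz : s != f z -> arc B s (f z) by rewrite -{1 2}(fid s sv) => /arcf; apply.
  have Bzt : f z != t -> arc B (f z) t by rewrite -{1 2}(fid t tv) => /arcf; apply.
  case: (eqVneq s (f z)) => [sfz|/Bsz{}Bsz]; first by rewrite sfz Bzt // -sfz.
  case: (eqVneq (f z) t) => [fzt|/Bzt{}Bzt]; first by rewrite -fzt Bsz.
  by apply/orP; right; apply/existsP; exists (f z); rewrite fnv Bsz.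
apply: leq_ltn_trans (f2_delete oB cB) _.
suff: #|B| < #|A|.
  by apply/leq_ltn_trans/subset_leq_card/subsetP=> a; rewrite inE => /andP[].
have leB : B \subset ff @: A by apply/subsetP=> a; rewrite inE => /andP[].
(* An arc between [u] and [v] becomes the discarded loop at [u]; a twin neighbour gives two arcs
   with the same image. *)
case/orP: near => [|/existsP[z tz]].
  move=> adj; apply: (leq_trans _ (leq_imset_card ff (mem A))).
  apply: proper_card; apply/properP; split=> //; exists (u, u); last by rewrite inE eqxx andbF.
  case/orP: adj => a; apply/imsetP; [exists (u, v)|exists (v, u)] => //;
    by rewrite /ff /= fu fv.
apply: leq_ltn_trans (subset_leq_card leB) _.
rewrite ltn_neqAle leq_imset_card andbT; apply/negP=> /imset_injP inj.
case/orP: tz => /andP[a b].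
  have /= := inj (u, z) (v, z) a b; rewrite /ff /= fu fv => /(_ erefl)[] /eqP.
  by rewrite (negbTE uv).
have /= := inj (z, u) (z, v) a b; rewrite /ff /= fu fv => /(_ erefl)[] /eqP.
by rewrite (negbTE uv).
Qed.

(** A source is never the middle of a directed path, so the other pairs stay close. Being close to
    some other vertex, it has an out-arc, which the deletion loses. *)
Lemma f2_delete_source n (A : {set 'I_n.+1 * 'I_n.+1}) (v : 'I_n.+1) :
  oriented A -> 0 < n ->
  (forall x y, x != y -> close A x y) -> (forall x, ~~ arc A x v) ->
  f2 n < #|A|.
Proof.
move=> oA n0 cA src.
have [w vw] : exists w, arc A v w.
  have /orP[/orP[a|a]|/existsP[z /orP[]/andP[a b]]] := cA _ _ (neq_lift v (Ordinal n0)).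
  - by exists (lift v (Ordinal n0)).
  - by rewrite (negbTE (src _)) in a.
  - by exists z.
  - by rewrite (negbTE (src z)) in b.
apply: leq_ltn_trans (f2_delete (v := v) oA _) _.
  move=> x y _ _ /cA/orP[->//|/existsP[z cz]]; apply/orP; right.
  apply/existsP; exists z; rewrite cz andbT.
  by apply: contraTneq cz => ->;
    rewrite /connector (negbTE (src x)) (negbTE (src y)).
apply: proper_card; apply/properP; split.
  by apply/subsetP=> a; rewrite inE => /andP[].
by exists (v, w) => //; rewrite inE /= eqxx andbF.
Qed.

Theorem theorem5 (n : nat) (hn : 1 <= n) : f2 n < f2 n.+1.
Proof.
have [A [oA cA <-]] := f2_spec n.+1.
have [/existsP[u /existsP[v /andP[uv /existsPn noc]]]|/existsPn conn] :=
  boolP [exists u, exists v, (u != v) && ~~ [exists z, connector A u v z]].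
  have := cA _ _ uv; rewrite /close => adj.
  apply: (f2_identify oA uv) => [x y _ _|//|]; first exact: cA.
  by case/orP: adj => [->//|/existsP[z]]; rewrite (negbTE (noc z)).
have [/existsP[u /existsP[v /andP[uv /existsPn notw]]]|/existsPn twin] :=
  boolP [exists u, exists v, (u != v) && ~~ [exists z, twin_nbr A u v z]].
  (* After pushing [v], the pair has no connector; if it is not adjacent, its old connector is now a
     twin neighbour, so identification still loses an arc. *)
  have uvZ : (u \in [set v]) (+) (v \in [set v]) by rewrite !inE eqxx (negbTE uv).
  rewrite -(card_push [set v]).
  apply: (f2_identify (oriented_push _ oA) uv) => [x y xv yv xy|z|].
  - have /orP[a|/existsP[z cz]] := cA _ _ xy.
      by rewrite /close adjacent_push a.
    apply/orP; right; apply/existsP; exists z.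
    by rewrite connector_push !inE (negbTE xv) (negbTE yv).
  - by rewrite connector_push uvZ.
  - rewrite adjacent_push; have /orP[->//|/existsP[z cz]] := cA _ _ uv.
    by apply/orP; right; apply/existsP; exists z; rewrite twin_nbr_push uvZ.
(* Any vertex would do as [v]. It lies outside [Z], so pushing [Z] reverses exactly the arcs
   entering it. *)
pose v : 'I_n.+1 := ord0; pose Z := [set x | arc A x v].
have [irr asym] := orientedP _ oA.
rewrite -(card_push Z); apply: (f2_delete_source (v := v)) => //.
- exact: oriented_push.
- move=> x y xy; apply/orP; right.
  have /existsPn/(_ y) := conn x; rewrite xy negbK => /existsP[s cs].
  have /existsPn/(_ y) := twin x; rewrite xy negbK => /existsP[t tt].
  apply/existsP; case E: ((x \in Z) (+) (y \in Z)).
    by exists t; rewrite connector_push E.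
  by exists s; rewrite connector_push E.
move=> x; rewrite arc_push !inE irr addbF.
by case: ifP => [xv|-> //]; apply/negP; apply: asym xv.
Qed.
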